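(* For every integer $n\geq 2$ and every $\theta\in\big[0,\frac{\pi}{2}\big]$, $$2n+1-(n+2)\,\frac{\sin n\theta}{\sin\theta}+(n-1)\,\frac{\sin (n+1)\theta}{\sin\theta}\;\geq\;0,$$ and, for $\theta\in\big[0,\frac{\pi}{2}\big]$, equality is attained only for $\theta=0$.
   Context: At $\theta=0$ the quotients are understood by continuity, i.e. $\frac{\sin m\theta}{\sin\theta}\big|_{\theta=0}=m$ for each positive integer $m$ (equivalently, $\frac{\sin m\theta}{\sin\theta}=U_{m-1}(\cos\theta)$, where $U_{m-1}$ is the Chebyshev polynomial of the second kind of degree $m-1$). *)

(* Defs.v *)
From Stdlib Require Import Reals Lra.
Open Scope R_scope.

(** The quotient [sin (m x) / sin x], completed at [x = 0] by its limit [m].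
    The other zeros of [sin] are not treated: the function is meant for
    [- PI < x < PI]. *)
Definition sin_quot (m : nat) (x : R) : R :=
  if Req_dec_T x 0 then INR m else sin (INR m * x) / sin x.

Lemma sin_quot_continuous_0 (m : nat) : continuity_pt (sin_quot m) 0.
Proof.
assert (Hlim : forall a : R,
  limit1_in (fun x => sin (a * x) / x) (D_x no_cond 0) a 0).
{ intros a.
  assert (D : derivable_pt_lim (fun x => sin (a * x)) 0 a).
  { assert (D : derivable_pt_lim (comp sin (mult_real_fct a id)) 0
                  (cos (a * 0) * (a * 1))).
    { apply derivable_pt_lim_comp.
      - apply derivable_pt_lim_scal, derivable_pt_lim_id.
      - apply derivable_pt_lim_sin. }
    rewrite Rmult_0_r, cos_0, Rmult_1_l, Rmult_1_r in D. exact D. }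
  intros eps He. destruct (D eps He) as [d Hd].
  exists d. split; [apply cond_pos|].
  intros x [[_ Hx] Hdist]. simpl in *. unfold Rdist in *.
  rewrite Rminus_0_r in Hdist.
  specialize (Hd x (not_eq_sym Hx) Hdist).
  now rewrite Rmult_0_r, sin_0, Rplus_0_l, Rminus_0_r in Hd. }
assert (Hq : limit1_in (fun x => sin (INR m * x) / x * / (sin (1 * x) / x))
               (D_x no_cond 0) (INR m * / 1) 0).
{ apply limit_mul; [apply Hlim|]. apply limit_inv; [apply Hlim | lra]. }
rewrite Rinv_1, Rmult_1_r in Hq.
intros eps He. destruct (Hq eps He) as [d [Hd H]].
exists d. split; [exact Hd|].
intros x Hx. specialize (H x Hx). destruct Hx as [[_ Hx] _].
unfold sin_quot. destruct (Req_dec_T 0 0) as [_|]; [|lra].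
destruct (Req_dec_T x 0) as [E|_]; [now symmetry in E|].
replace (sin (INR m * x) / sin x)
  with (sin (INR m * x) / x * / (sin (1 * x) / x)); [exact H|].
rewrite Rmult_1_l. unfold Rdiv. rewrite Rinv_mult, Rinv_inv.
transitivity (sin (INR m * x) * / sin x * (/ x * x)); [ring|].
rewrite Rinv_l by (now apply not_eq_sym). ring.
Qed.

(* Main.v *)
Require Import Defs.
From Stdlib Require Import Reals Lra Lia.
Open Scope R_scope.

(** For [0 < theta], multiply the expression by [sin theta] to obtain
    [e n = (2n+1) sin theta - (n+2) sin (n theta) + (n-1) sin ((n+1) theta)],
    which has to be positive.

    The sequence [e] vanishes at [n = 0] and [n = 1], and its second difference
    at [n] is [2 (1 - cos theta) g n] with
    [g n = (n+1) sin (n theta) - n sin ((n+1) theta)]; in turn [g 0 = 0] and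
    [g] has increments [2 (n+1) (1 - cos theta) sin ((n+1) theta)].  Hence, as
    long as the multiples of [theta] involved stay in the first half-period of
    the sine, [g] is positive ([sin_gap_pos]), [e] is convex, and
    [e n > 0] for [n >= 2] ([numerator_pos_first_arch]).

    Once [n theta >= PI], size alone suffices.  With [h = theta / 2] and
    [a = (2n+1) h] one has
    [e n = M (2 cos h + cos a) - 3 cos h sin a], where [M = (2n+1) sin h].
    By Cauchy-Schwarz the part depending on [a] is at least
    [- sqrt (M^2 + 9 (cos h)^2)].  This loses to [2 M cos h] because
    [(cos h)^2 >= 1/2], which is where [theta <= PI / 2] enters, and
    [M >= 5/2] ([numerator_pos_far]). *)

(** [sin x] times the expression whose sign is studied. *)
Definition numerator (x : R) (n : nat) : R :=
  (2 * INR n + 1) * sin x - (INR n + 2) * sin (INR n * x)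
  + (INR n - 1) * sin (INR (S n) * x).

Definition sin_gap (x : R) (n : nat) : R :=
  INR (S n) * sin (INR n * x) - INR n * sin (INR (S n) * x).

Lemma sin_multiple_rec (x : R) (n : nat) :
  sin (INR (S (S n)) * x) =
  2 * cos x * sin (INR (S n) * x) - sin (INR n * x).
Proof.
replace (INR (S (S n)) * x) with (INR (S n) * x + x) by (rewrite !S_INR; ring).
replace (INR n * x) with (INR (S n) * x - x) by (rewrite !S_INR; ring).
rewrite sin_plus, sin_minus. ring.
Qed.

Lemma cos_lt_1 (x : R) : 0 < x < PI -> cos x < 1.
Proof.
intros Hx. rewrite <- cos_0. apply cos_decreasing_1; lra.
Qed.

Lemma sin_gap_step (x : R) (n : nat) :
  sin_gap x (S n) =
  sin_gap x n + 2 * INR (S n) * (1 - cos x) * sin (INR (S n) * x).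
Proof.
unfold sin_gap. rewrite sin_multiple_rec, !S_INR. ring.
Qed.

Lemma sin_gap_pos (x : R) (n : nat) :
  0 < x -> INR (S n) * x < PI -> 0 < sin_gap x (S n).
Proof.
intros Hx. induction n as [|n IH]; intros Hn;
  rewrite sin_gap_step.
- simpl INR in *. rewrite Rmult_1_l in *.
  assert (Hc := cos_lt_1 x (conj Hx Hn)).
  assert (Hs := sin_gt_0 x Hx Hn).
  unfold sin_gap. simpl INR. rewrite !Rmult_0_l, sin_0. nra.
- assert (H1 : 1 <= INR (S (S n))) by (rewrite !S_INR; pose proof (pos_INR n); lra).
  assert (Hlt : INR (S n) * x < PI) by (rewrite (S_INR (S n)) in Hn; nra).
  specialize (IH Hlt).
  assert (Hc : cos x < 1) by (apply cos_lt_1; nra).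
  assert (Hs : 0 < sin (INR (S (S n)) * x)) by (apply sin_gt_0; nra).
  assert (0 < 2 * INR (S (S n)) * (1 - cos x) * sin (INR (S (S n)) * x))
    by (repeat apply Rmult_lt_0_compat; lra).
  lra.
Qed.

Lemma numerator_second_difference (x : R) (n : nat) :
  numerator x (S (S n)) - numerator x (S n) =
  numerator x (S n) - numerator x n + 2 * (1 - cos x) * sin_gap x (S n).
Proof.
unfold numerator, sin_gap.
rewrite (sin_multiple_rec x (S n)), (sin_multiple_rec x n), !S_INR. ring.
Qed.

Lemma numerator_0 (x : R) : numerator x 0 = 0.
Proof.
unfold numerator. simpl INR. rewrite Rmult_0_l, Rmult_1_l, sin_0. ring.
Qed.

Lemma numerator_1 (x : R) : numerator x 1 = 0.
Proof.
unfold numerator. simpl INR. rewrite Rmult_1_l. ring.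
Qed.

(** A strictly convex sequence that vanishes at [0] and [1] is positive and
    increasing afterwards; the induction carries both facts. *)
Lemma numerator_pos_first_arch (x : R) (n : nat) :
  0 < x -> INR (S n) * x < PI ->
  0 < numerator x (S (S n)) /\ numerator x (S n) < numerator x (S (S n)).
Proof.
intros Hx. induction n as [|n IH]; intros Hn;
  pose proof (sin_gap_pos x _ Hx Hn) as Hg;
  assert (Hc : cos x < 1)
    by (apply cos_lt_1; rewrite S_INR in Hn;
        match type of Hn with (INR ?k + 1) * x < PI =>
          pose proof (pos_INR k) end; nra).
- pose proof (numerator_second_difference x 0) as H.
  rewrite numerator_0, numerator_1 in *. nra.
- assert (Hlt : INR (S n) * x < PI) by (rewrite (S_INR (S n)) in Hn; nra).
  destruct (IH Hlt) as [H0 H1].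
  pose proof (numerator_second_difference x (S n)) as H.
  assert (0 < 2 * (1 - cos x) * sin_gap x (S (S n)))
    by (repeat apply Rmult_lt_0_compat; lra).
  lra.
Qed.

Lemma numerator_half_angle (x : R) (n : nat) :
  let h := x / 2 in
  let N := 2 * INR n + 1 in
  numerator x n =
  N * sin h * (2 * cos h + cos (N * h)) - 3 * cos h * sin (N * h).
Proof.
intros h N. unfold numerator.
replace (INR n * x) with (N * h - h) by (unfold N, h; field).
replace (INR (S n) * x) with (N * h + h)
  by (unfold N, h; rewrite S_INR; field).
replace (sin x) with (sin (2 * h)) by (f_equal; unfold h; field).
rewrite sin_2a, sin_minus, sin_plus. unfold N. ring.
Qed.

Lemma sin_ge_five_sixths (h : R) : 0 <= h <= 1 -> 5 / 6 * h <= sin h.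
Proof.
intros Hh.
(* The Taylor bound [h - h^3/6 <= sin h]. *)
assert (Hb : sin_approx h (2 * 0 + 1) <= sin h)
  by (apply sin_bound; pose proof PI2_3_2; lra).
unfold sin_approx, sin_term in Hb. simpl in Hb. nra.
Qed.

(** Cauchy-Schwarz for the vectors [(M, - 3 c)] and [(C, S)]; the numerical
    hypotheses give [M^2 + 9 c^2 < (2 M c)^2]. *)
Lemma trig_form_pos (M c C S : R) :
  5 / 2 <= M -> 0 <= c -> 1 / 2 <= c² -> S² + C² = 1 ->
  0 < M * (2 * c + C) - 3 * c * S.
Proof.
unfold Rsqr. intros HM Hc Hc2 HSC.
set (X := 3 * c * S - M * C).
assert (HX : X * X <= M * M + 9 * (c * c)).
{ assert (E : X * X + (3 * c * C + M * S) * (3 * c * C + M * S)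
              = (M * M + 9 * (c * c)) * (S * S + C * C)) by (unfold X; ring).
  rewrite HSC in E.
  pose proof (Rle_0_sqr (3 * c * C + M * S)) as H. unfold Rsqr in H. lra. }
assert (Hlarge : M * M + 9 * (c * c) < (2 * M * c) * (2 * M * c)).
{ assert (25 / 4 <= M * M) by nra.
  assert (0 <= (M * M - 25 / 4) * (c * c - 1 / 2)) by (apply Rmult_le_pos; lra).
  lra. }
assert (X < 2 * M * c).
{ assert (0 <= 2 * M * c) by nra. nra. }
unfold X in *. lra.
Qed.

Lemma numerator_pos_far (x : R) (n : nat) :
  0 <= x <= PI / 2 -> PI <= INR n * x -> 0 < numerator x n.
Proof.
intros Hx Hn. rewrite numerator_half_angle.
pose proof PI_4 as Hpi. pose proof PI2_3_2 as Hpi'. pose proof (pos_INR n) as Hp.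
apply trig_form_pos.
- (* [(2n+1) x/2 >= n x >= PI >= 3], and [3 * 5/6 = 5/2]. *)
  assert (Hs := sin_ge_five_sixths (x / 2) ltac:(lra)).
  assert ((2 * INR n + 1) * (5 / 6 * (x / 2)) <= (2 * INR n + 1) * sin (x / 2))
    by (apply Rmult_le_compat_l; lra).
  lra.
- apply cos_ge_0; lra.
- assert (H : 0 <= cos x) by (apply cos_ge_0; lra).
  replace x with (2 * (x / 2)) in H by field.
  rewrite cos_2a_cos in H. unfold Rsqr. lra.
- apply sin2_cos2.
Qed.

Lemma numerator_pos (x : R) (n : nat) :
  (2 <= n)%nat -> 0 < x <= PI / 2 -> 0 < numerator x n.
Proof.
intros Hn Hx. destruct n as [|[|n]]; [lia | lia |].
destruct (Rlt_le_dec (INR (S n) * x) PI) as [H|H].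
- apply numerator_pos_first_arch; lra.
- apply numerator_pos_far; [lra|]. rewrite (S_INR (S n)). lra.
Qed.

Theorem corollary2 :
  forall (n : nat) (theta : R),
    (2 <= n)%nat ->
    0 <= theta <= PI / 2 ->
    let E := 2 * INR n + 1 - (INR n + 2) * sin_quot n theta
             + (INR n - 1) * sin_quot (n + 1) theta in
    E >= 0 /\ (E = 0 <-> theta = 0).
Proof.
intros n x Hn Hx E. unfold E, sin_quot. clear E.
destruct (Req_dec_T x 0) as [H0|H0].
- rewrite plus_INR. simpl (INR 1).
  replace (2 * INR n + 1 - (INR n + 2) * INR n + (INR n - 1) * (INR n + 1))
    with 0 by ring.
  split; [lra | tauto].
- assert (Hpos := numerator_pos x n Hn ltac:(lra)).
  assert (Hs : 0 < sin x) by (apply sin_gt_0; pose proof PI_RGT_0; lra).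
  replace (n + 1)%nat with (S n) by lia.
  replace (2 * INR n + 1 - (INR n + 2) * (sin (INR n * x) / sin x)
           + (INR n - 1) * (sin (INR (S n) * x) / sin x))
    with (numerator x n / sin x) by (unfold numerator; field; lra).
  assert (0 < numerator x n / sin x) by (apply Rdiv_lt_0_compat; lra).
  split; [lra|]. split; intros; lra.
Qed.
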